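(* Let $n$ and $r$ be integers with $0\leq r\leq n-3$, and let $\mathbb{G}(n,r)$ denote the set of all connected graphs with $n$ vertices and exactly $r$ cut edges. If $G\in\mathbb{G}(n,r)$, then $SLEE(G)\leq SLEE(G_{n,r})$, with equality if and only if $G=G_{n,r}$ (up to isomorphism).
   Context: All graphs are finite and simple. For a graph $G$ on $n$ vertices, let $\mathbf{Q}(G)=\mathbf{D}(G)+\mathbf{A}(G)$ be its signless Laplacian matrix, where $\mathbf{A}(G)$ is the adjacency matrix and $\mathbf{D}(G)$ the diagonal matrix of vertex degrees; let $q_1,\dots,q_n$ be the eigenvalues of $\mathbf{Q}(G)$. The signless Laplacian Estrada index of $G$ is $SLEE(G)=\sum_{i=1}^n e^{q_i}$. A cut edge of a connected graph is an edge whose removal disconnects the graph. $K_m$ is the complete graph on $m$ vertices. For $a\geq 1$ and $b\geq 0$, $G_{a+b,b}$ is the graph on $a+b$ vertices obtained from $K_a$ by adding $b$ new vertices, each joined by a single edge to one and the same vertex of $K_a$; thus $G_{n,r}$ is obtained from $K_{n-r}$ by attaching $r$ new vertices to one fixed vertex of $K_{n-r}$. *)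

(* Defs.v *)
From HB Require Import structures.
From mathcomp Require Import all_boot all_order all_algebra all_fingroup.
From mathcomp Require Import reals sequences exp.
From mathcomp Require Import complex.
From mathcomp Require polyrcf.

Set Implicit Arguments.
Unset Strict Implicit.
Unset Printing Implicit Defensive.

Import Order.TTheory GRing.Theory Num.Theory.
Local Open Scope ring_scope.

Record sgraph (n : nat) := SGraph {
  adj :> rel 'I_n;
  adj_sym : symmetric adj;
  adj_irrefl : irreflexive adj
}.

Definition graph_iso n (G H : sgraph n) : Prop :=
  exists f : {perm 'I_n}, forall x y, G x y = H (f x) (f y).

(* [connect] is the reflexive transitive closure of the adjacency relation. *)
Definition graph_connected n (G : sgraph n) : bool :=
  [forall x, forall y, connect G x y].

Definition edges n (G : sgraph n) : {set {set 'I_n}} :=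
  [set [set p.1; p.2] | p : 'I_n * 'I_n & G p.1 p.2].

Definition del_adj n (G : sgraph n) (E : {set 'I_n}) : rel 'I_n :=
  fun x y => G x y && ([set x; y] != E).

Lemma del_adj_sym n (G : sgraph n) E : symmetric (del_adj G E).
Proof. by move=> x y; rewrite /del_adj adj_sym setUC. Qed.

Lemma del_adj_irrefl n (G : sgraph n) E : irreflexive (del_adj G E).
Proof. by move=> x; rewrite /del_adj adj_irrefl. Qed.

Definition del_edge n (G : sgraph n) (E : {set 'I_n}) : sgraph n :=
  SGraph (del_adj_sym G E) (del_adj_irrefl G E).

(* Only meaningful for a connected [G]. *)
Definition cut_edges n (G : sgraph n) : {set {set 'I_n}} :=
  [set E in edges G | ~~ graph_connected (del_edge G E)].

Definition connected_with_cut_edges (n r : nat) (G : sgraph n) : Prop :=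
  graph_connected G /\ #|cut_edges G| = r.

(* The clique is {0, ..., n - r - 1}; the remaining r vertices are pendant at
   vertex 0.  Intended for r < n. *)
Definition pendant_clique_adj (n r : nat) : rel 'I_n := fun x y =>
  (x != y) &&
  [|| (x < n - r)%N && (y < n - r)%N,
      (x == 0 :> nat) && (n - r <= y)%N |
      (y == 0 :> nat) && (n - r <= x)%N].

Lemma pendant_clique_adj_sym n r : symmetric (@pendant_clique_adj n r).
Proof.
move=> x y; rewrite /pendant_clique_adj eq_sym; congr (_ && _).
by rewrite [in LHS]andbC [X in _ || X = _]orbC.
Qed.

Lemma pendant_clique_adj_irrefl n r : irreflexive (@pendant_clique_adj n r).
Proof. by move=> x; rewrite /pendant_clique_adj eqxx. Qed.

Definition pendant_clique (n r : nat) : sgraph n :=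
  SGraph (@pendant_clique_adj_sym n r) (@pendant_clique_adj_irrefl n r).

Lemma char_poly_similar (F : fieldType) n (P D : 'M[F]_n) :
  P \in unitmx -> char_poly (invmx P *m D *m P) = char_poly D.
Proof.
move=> uP; rewrite /char_poly.
have -> : char_poly_mx (invmx P *m D *m P) =
    map_mx polyC (invmx P) *m char_poly_mx D *m map_mx polyC P.
  rewrite /char_poly_mx mulmxBr mulmxBl !map_mxM; congr (_ - _).
  by rewrite mul_mx_scalar -scalemxAl -map_mxM mulVmx // map_mx1 scalemx1.
rewrite !det_mulmx mulrAC -det_mulmx -map_mxM mulVmx // map_mx1 det1 mul1r //.
Qed.

Lemma char_poly_symmetric_split (R : rcfType) n (M : 'M[R]_n) :
  M^T = M -> exists s : seq R, char_poly M = \prod_(x <- s) ('X - x%:P).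
Proof.
move=> symM; pose C : numClosedFieldType := R[i]%C.
pose f : {rmorphism R -> C} := real_complex R.
have Mre : map_mx f M \is a mxOver Num.real.
  apply/mxOverP => i j; rewrite mxE; apply/complex_realP; by exists (M i j).
have Mh : map_mx f M \is hermsymmx.
  apply: realsym_hermsym Mre.
  by apply/is_hermitianmxP; rewrite expr0 scale1r map_mx_id // map_trmx symM.
pose d := spectral_diag (map_mx f M).
have dre := hermitian_spectral_diag_real Mh.
have /orthomx_spectralP E := hermitian_normalmx Mh.
exists [seq complex.Re (d 0 i) | i : 'I_n].
apply: (map_poly_inj f); rewrite map_char_poly E.
rewrite char_poly_similar ?spectral_unit //.
rewrite char_poly_trig ?diag_mx_is_trig // rmorph_prod big_image /=.
apply: eq_bigr => i _.
rewrite rmorphB /= map_polyX map_polyC /= mxE eqxx mulr1n; congr (_ - _%:P).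
by have /mxOverP/(_ 0 i)/RRe_real := dre.
Qed.

Section SLEE.
Variable R : realType.

Definition degree n (G : sgraph n) (x : 'I_n) : nat := #|[set y | G x y]|.

Definition adjacency_mx n (G : sgraph n) : 'M[R]_n :=
  \matrix_(x, y) (G x y)%:R.

Definition degree_mx n (G : sgraph n) : 'M[R]_n :=
  diag_mx (\row_x (degree G x)%:R).

Definition signless_laplacian n (G : sgraph n) : 'M[R]_n :=
  degree_mx G + adjacency_mx G.

(* The real eigenvalues, each repeated according to its multiplicity as a root
   of the characteristic polynomial; by [char_poly_eigenvalues] these are all
   the eigenvalues when [M] is symmetric. *)
Definition eigenvalues n (M : 'M[R]_n) : seq R :=
  flatten [seq nseq (mup x (char_poly M)) x | x <- polyrcf.rootsR (char_poly M)].

Lemma char_poly_eigenvalues n (M : 'M[R]_n) :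
  M^T = M -> char_poly M = \prod_(q <- eigenvalues M) ('X - q%:P).
Proof.
move=> /char_poly_symmetric_split[s sE].
have p0 : char_poly M != 0 by exact/monic_neq0/char_poly_monic.
rewrite {1}sE; apply: perm_big; rewrite perm_sym.
apply: perm_trans (perm_count_undup s).
rewrite /eigenvalues; apply: perm_flatten.
under eq_map do rewrite sE mu_prod_XsubC.
apply: perm_map; apply: uniq_perm.
- exact: polyrcf.uniq_roots.
- exact: undup_uniq.
move=> x; rewrite mem_undup -[RHS]root_prod_XsubC -sE.
by have := polyrcf.roots_on_rootsR p0 x; rewrite in_itv /= => <-.
Qed.

Lemma signless_laplacian_sym n (G : sgraph n) :
  (signless_laplacian G)^T = signless_laplacian G.
Proof.
rewrite /signless_laplacian linearD /= tr_diag_mx; congr (_ + _).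
by apply/matrixP => x y; rewrite !mxE adj_sym.
Qed.

Definition SLEE n (G : sgraph n) : R :=
  \sum_(q <- eigenvalues (signless_laplacian G)) expR q.

End SLEE.

(* Main.v *)
(* The index is a sum over [k] of the traces of [Q ^+ k], weighted by [1 / k!].
   Moving the private neighbours of a vertex [u] to a vertex [v] (the Kelmans
   transformation) increases every such trace: in the orthogonal basis made of
   [e_u + e_v], [e_v - e_u] and the other basis vectors, the new matrix dominates
   the absolute values of the entries of the old one, strictly in one entry as
   soon as both [u] and [v] have private neighbours.
   Take a maximizer of the index among the connected graphs with at least [r] cut
   edges.  Every cut edge has an end of degree 1, as otherwise the transformation
   along that edge improves the graph.  Fix [r] vertices of degree 1.  The other
   vertices form a clique, as otherwise an edge can be added; and all of the [r]
   vertices hang on the same vertex of it, as otherwise the transformation applied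
   to two attachment vertices improves the graph. *)
Require Import Defs.
From mathcomp Require Import all_boot all_order all_algebra all_fingroup.
From mathcomp Require Import reals sequences exp topology normedtype.
From mathcomp Require Import boolp complex lra.
Import numFieldNormedType.Exports.

Set Implicit Arguments.
Unset Strict Implicit.
Unset Printing Implicit Defensive.

Import Order.TTheory GRing.Theory Num.Theory.
Local Open Scope ring_scope.

(** * Exponential sums as limits of weighted power sums *)

Section ExpSums.
Local Open Scope classical_set_scope.
Variable R : realType.
Implicit Types s t : seq R.

Lemma cvg_series_power_sum s :
  series (fun k => k`!%:R^-1 * \sum_(q <- s) q ^+ k) @ \oo
    --> \sum_(q <- s) expR q.
Proof.
elim: s => [|q s IHs].
  rewrite big_nil (_ : series _ = fun=> 0); first exact: cvg_cst.
  by apply/funext => m; apply: big1 => k _; rewrite big_nil mulr0.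
rewrite big_cons (_ : series _ = series (exp_coeff q) \+
    series (fun k => k`!%:R^-1 * \sum_(q <- s) q ^+ k)).
  by apply: cvgD IHs; apply: is_cvg_series_exp_coeff.
apply/funext => m; rewrite /series /= -big_split /=; apply: eq_bigr => k _.
by rewrite big_cons mulrDr exp_coeffE.
Qed.

Lemma ltr_sum_expR s t j :
  (forall k, \sum_(q <- s) q ^+ k <= \sum_(q <- t) q ^+ k) ->
  \sum_(q <- s) q ^+ j < \sum_(q <- t) q ^+ j ->
  \sum_(q <- s) expR q < \sum_(q <- t) expR q.
Proof.
move=> le_st lt_st.
set d := \sum_(q <- t) q ^+ j - \sum_(q <- s) q ^+ j.
have d_gt0 : 0 < j`!%:R^-1 * d.
  by rewrite mulr_gt0 ?subr_gt0 // invr_gt0 ltr0n fact_gt0.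
(* Limits preserve only weak inequalities, so the weighted gap at exponent [j] is added to the
   smaller side before passing to the limit; partial sums with more than [j] terms already contain
   it. *)
apply: (@lt_le_trans _ _ (\sum_(q <- s) expR q + j`!%:R^-1 * d)).
  by rewrite ltrDl.
apply: ler_cvg_to (cvgD (@cvg_series_power_sum s) (cvg_cst _))
  (@cvg_series_power_sum t) _.
exists j.+1 => // m /= lt_jm.
rewrite -[leLHS]/(series _ m + j`!%:R^-1 * d) /series /= !big_mkord.
rewrite (bigD1 (Ordinal lt_jm)) // [leRHS](bigD1 (Ordinal lt_jm)) //=.
rewrite addrAC -mulrDr [X in _ * X + _]addrC subrK lerD2l.
by apply: ler_sum => k _; rewrite ler_wpM2l // invr_ge0 ler0n.
Qed.

End ExpSums.

(** * Power sums of eigenvalues as traces of powers *)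

Section Traces.
Variable R : comUnitRingType.

Lemma exprmx_similar n (P A : 'M[R]_n) k : P \in unitmx ->
  (invmx P *m A *m P) ^+ k = invmx P *m A ^+ k *m P.
Proof.
move=> uP; elim: k => [|k IHk]; first by rewrite !expr0 mulmx1 mulVmx.
by rewrite !exprSr IHk -!mulmxE !mulmxA mulmxK.
Qed.

Lemma mxtrace_similar n (P A : 'M[R]_n) : P \in unitmx ->
  \tr (invmx P *m A *m P) = \tr A.
Proof. by move=> uP; rewrite mxtrace_mulC mulmxA mulmxV // mul1mx. Qed.

Lemma diag_mx_exp n (d : 'rV[R]_n) k :
  diag_mx d ^+ k = diag_mx (\row_i d 0 i ^+ k).
Proof.
elim: k => [|k IHk].
  by rewrite expr0; apply/matrixP => i j; rewrite !mxE expr0.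
rewrite exprS IHk -mulmxE mulmx_diag; congr diag_mx.
by apply/rowP => i; rewrite !mxE exprS.
Qed.

End Traces.

Section Spectrum.
Variable R : realType.

(** Over the complex numbers the spectral theorem makes [M] similar to a diagonal matrix with real
    entries [d], from which both sides are read off. *)
Lemma power_sum_eigenvalues n (M : 'M[R]_n) k : M^T = M ->
  \sum_(q <- eigenvalues M) q ^+ k = \tr (M ^+ k).
Proof.
move=> symM; pose C : numClosedFieldType := R[i]%C.
pose f : {rmorphism R -> C} := real_complex R.
have Mre : map_mx f M \is a mxOver Num.real.
  by apply/mxOverP => i j; rewrite mxE; apply/complex_realP; exists (M i j).
have Mh : map_mx f M \is hermsymmx.
  apply: realsym_hermsym Mre.
  by apply/is_hermitianmxP; rewrite expr0 scale1r map_mx_id // map_trmx symM.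
pose d := spectral_diag (map_mx f M).
have dre i : f (complex.Re (d 0 i)) = d 0 i.
  by have /mxOverP/(_ 0 i)/RRe_real := hermitian_spectral_diag_real Mh.
have /orthomx_spectralP E := hermitian_normalmx Mh.
have eig_d : perm_eq (eigenvalues M) [seq complex.Re (d 0 i) | i : 'I_n].
  apply: prod_XsubC_eq; rewrite -char_poly_eigenvalues //.
  apply: (map_poly_inj f); rewrite map_char_poly E.
  rewrite char_poly_similar ?spectral_unit //.
  rewrite char_poly_trig ?diag_mx_is_trig // rmorph_prod big_image /=.
  apply: eq_bigr => i _.
  by rewrite rmorphB /= map_polyX map_polyC /= dre mxE eqxx mulr1n.
rewrite (perm_big _ eig_d) /=; apply: (fmorph_inj f).
rewrite -trace_map_mx rmorphXn /= E exprmx_similar ?spectral_unit //.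
rewrite mxtrace_similar ?spectral_unit // diag_mx_exp mxtrace_diag.
rewrite rmorph_sum big_image /=; apply: eq_bigr => i _.
by rewrite rmorphXn /= dre !mxE.
Qed.

End Spectrum.

(** * Entrywise domination of matrices *)

Section Domination.
Variable R : realType.

Lemma ler_norm_exprmx n (A B : 'M[R]_n) k :
  (forall i j, `|A i j| <= B i j) ->
  forall i j, `|(A ^+ k) i j| <= (B ^+ k) i j.
Proof.
move=> leAB; elim: k => [|k IHk] i j.
  by rewrite !expr0 !mxE normr_nat.
rewrite !exprS -!mulmxE !mxE; apply: le_trans (ler_norm_sum _ _ _) _.
by apply: ler_sum => l _; rewrite normrM ler_pM.
Qed.

(* Conjugation by [P] preserves the traces of powers, and after it [B] dominates
   [A] entrywise; the strict inequality shows in the trace of the square. *)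
Lemma sum_expR_eigenvalues_lt n (A B P : 'M[R]_n) (d : 'rV_n) (i0 j0 : 'I_n) :
  A^T = A -> B^T = B ->
  (forall i, 0 < d 0 i) -> P^T *m P = diag_mx d ->
  (forall i j, `|(P^T *m A *m P) i j| <= (P^T *m B *m P) i j) ->
  `|(P^T *m A *m P) i0 j0| < (P^T *m B *m P) i0 j0 ->
  \sum_(q <- eigenvalues A) expR q < \sum_(q <- eigenvalues B) expR q.
Proof.
move=> symA symB d_gt0 PtP leAB ltAB.
pose d' : 'rV[R]_n := \row_i (d 0 i)^-1.
have d'_gt0 i : 0 < d' 0 i by rewrite mxE invr_gt0.
(* The columns of [P] are orthogonal with squared norms [d], so the inverse of [P] is its transpose
   with rows divided by [d]. *)
have P'P : diag_mx d' *m P^T *m P = 1%:M.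
  rewrite -mulmxA PtP mulmx_diag -diag_const_mx; congr diag_mx.
  by apply/rowP => i; rewrite !mxE mulVf // gt_eqF.
have [_ uP] := mulmx1_unit P'P.
have invP : invmx P = diag_mx d' *m P^T.
  by rewrite -[RHS]mulmx1 -(mulmxV uP) mulmxA P'P mul1mx.
pose M C := invmx P *m C *m P.
have ME C i j : M C i j = d' 0 i * (P^T *m C *m P) i j.
  by rewrite /M invP -!mulmxA mul_diag_mx mxE.
have sym C : C^T = C -> (P^T *m C *m P)^T = P^T *m C *m P.
  by move=> symC; rewrite !trmx_mul trmxK symC mulmxA.
have symE C i j : C^T = C -> (P^T *m C *m P) i j = (P^T *m C *m P) j i.
  by move=> /sym {1}<-; rewrite mxE.
have leM i j : `|M A i j| <= M B i j.
  by rewrite !ME normrM gtr0_norm // ler_wpM2l // ltW.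
have psE C k : C^T = C -> \sum_(q <- eigenvalues C) q ^+ k = \tr (M C ^+ k).
  by move=> symC; rewrite power_sum_eigenvalues // exprmx_similar ?mxtrace_similar.
apply: (@ltr_sum_expR _ _ _ 2) => [k|]; rewrite !psE //.
  by apply: ler_sum => i _; apply: le_trans (ler_norm _) (ler_norm_exprmx _ leM _ _).
(* [M C] need not be symmetric, but [P^T *m C *m P] is; the trace of the square thus becomes a
   positively weighted sum of squares, in which a single strict entry is visible. *)
have trE C : C^T = C ->
    \tr (M C ^+ 2) = \sum_i \sum_j d' 0 i * d' 0 j * (P^T *m C *m P) i j ^+ 2.
  move=> symC; apply: eq_bigr => i _; rewrite expr2 -mulmxE mxE.
  by apply: eq_bigr => j _; rewrite !ME [in X in _ * X]symE // mulrACA expr2.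
rewrite !trE //.
have leE i j : d' 0 i * d' 0 j * (P^T *m A *m P) i j ^+ 2
             <= d' 0 i * d' 0 j * (P^T *m B *m P) i j ^+ 2.
  rewrite ler_pM2l ?mulr_gt0 // -real_normK ?num_real // lerXn2r ?nnegrE //.
  exact: le_trans (leAB _ _).
rewrite (bigD1 i0) // [ltRHS](bigD1 i0) //= ltr_leD //; last first.
  by apply: ler_sum => i _; apply: ler_sum.
rewrite (bigD1 j0) // [ltRHS](bigD1 j0) //= ltr_leD //; last exact: ler_sum.
rewrite ltr_pM2l ?mulr_gt0 // -real_normK ?num_real // ltrXn2r ?nnegrE //.
Qed.

End Domination.

(** * The Kelmans transformation *)

Section Kelmans.
Variables (n : nat) (G : sgraph n) (u v : 'I_n).

(** [G] is compared with its image under the transposition of [u] and [v]: intersection on pairs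
    meeting [u], union elsewhere. Pairs avoiding both vertices, and the pair [u], [v] itself, are
    fixed by the transposition and keep their status. *)
Definition kelmans_adj : rel 'I_n := fun x y =>
  let e := G (tperm u v x) (tperm u v y) in
  if (x == u) || (y == u) then G x y && e else G x y || e.

Lemma kelmans_adj_sym : symmetric kelmans_adj.
Proof.
by move=> x y; rewrite /kelmans_adj orbC adj_sym [G (tperm _ _ x) _]adj_sym.
Qed.

Lemma kelmans_adj_irrefl : irreflexive kelmans_adj.
Proof. by move=> x; rewrite /kelmans_adj !adj_irrefl if_same. Qed.

(* In terms of neighbourhoods: the neighbours of [u] other than [v] that are not
   adjacent to [v] are disconnected from [u] and joined to [v] instead. *)
Definition kelmans : sgraph n := SGraph kelmans_adj_sym kelmans_adj_irrefl.

Lemma kelmans_out x y : x != u -> x != v -> y != u -> y != v ->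
  kelmans x y = G x y.
Proof.
move=> xu xv yu yv; rewrite /= /kelmans_adj (negPf xu) (negPf yu) /=.
by rewrite !tpermD 1?eq_sym // orbb.
Qed.

Lemma kelmans_src w : w != u -> w != v -> kelmans w u = G w u && G w v.
Proof.
move=> wu wv; rewrite /= /kelmans_adj eqxx orbT tpermL.
by rewrite tpermD 1?eq_sym.
Qed.

Lemma kelmans_dst w : w != u -> w != v -> kelmans w v = G w u || G w v.
Proof.
move=> wu wv; rewrite /= /kelmans_adj (negPf wu) /= tpermR tpermD 1?eq_sym //.
case: (eqVneq v u) wv => [->|_] wv; first by rewrite andbb orbb.
by rewrite orbC.
Qed.

Lemma kelmans_src_dst : kelmans u v = G u v.
Proof. by rewrite /= /kelmans_adj eqxx tpermL tpermR adj_sym andbb. Qed.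

End Kelmans.

(** * Growth of the index under edge addition and the Kelmans transformation *)

Section SLEEMonotone.
Variable R : realType.

Lemma signless_laplacianE n (G : sgraph n) x y :
  signless_laplacian R G x y =
  if x == y then \sum_z (G x z)%:R else (G x y)%:R.
Proof.
rewrite !mxE; case: eqVneq => [->|_]; last by rewrite add0r.
rewrite mulr1n adj_irrefl addr0 /degree -sum1dep_card natr_sum.
by rewrite big_mkcond; apply: eq_bigr => z _; case: (G _ _).
Qed.

Lemma signless_laplacian_ge0 n (G : sgraph n) x y :
  0 <= signless_laplacian R G x y.
Proof. by rewrite signless_laplacianE; case: ifP => _ //; apply: sumr_ge0. Qed.

(** All entries are nonnegative, so domination already holds in the standard basis, strictly at the
    new edge. *)
Lemma SLEE_lt_subgraph n (G H : sgraph n) x y :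
  subrel G H -> ~~ G x y -> H x y -> SLEE R G < SLEE R H.
Proof.
move=> sGH nGxy Hxy.
have le_adj a b : (G a b)%:R <= (H a b)%:R :> R.
  by rewrite ler_nat; case: (boolP (G a b)) => // /sGH ->.
apply: (@sum_expR_eigenvalues_lt _ _ _ _ 1%:M (const_mx 1) x y).
- exact: signless_laplacian_sym.
- exact: signless_laplacian_sym.
- by move=> i; rewrite mxE.
- by rewrite trmx1 mul1mx diag_const_mx.
- move=> i j; rewrite trmx1 !mul1mx !mulmx1 ger0_norm ?signless_laplacian_ge0 //.
  rewrite !signless_laplacianE; case: ifP => _ //.
  by apply: ler_sum => z _.
have xy : x != y by apply: contraTneq Hxy => ->; rewrite adj_irrefl.
rewrite trmx1 !mul1mx !mulmx1 !signless_laplacianE (negPf xy) (negPf nGxy) Hxy.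
by rewrite normr0.
Qed.

(* The columns of this matrix are [e_u + e_v] and [e_v - e_u] together with the
   remaining basis vectors. *)
Definition swap_basis n (u v : 'I_n) : 'M[R]_n :=
  1%:M + delta_mx v u - delta_mx u v.

Lemma mulmx_swap_basis n (u v : 'I_n) m (A : 'M[R]_(m, n)) i j : u != v ->
  (A *m swap_basis u v) i j =
  if j == u then A i u + A i v else if j == v then A i v - A i u else A i j.
Proof.
move=> uv; rewrite /swap_basis mulmxBr mulmxDr mulmx1 !mxE.
have delta a b : \sum_k A i k * delta_mx a b k j = A i a * (j == b)%:R.
  rewrite (bigD1 a) //= mxE eqxx big1 ?addr0 // => k ka.
  by rewrite mxE (negPf ka) mulr0.
rewrite !delta; case: (eqVneq j u) => [->|_].
  by rewrite (negPf uv) mulr1 mulr0 subr0.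
by case: (eqVneq j v) => [->|_]; rewrite ?mulr0 ?mulr1 !(addr0, subr0).
Qed.

Lemma swap_basis_congr n (u v : 'I_n) (A : 'M[R]_n) i j : u != v -> A^T = A ->
  let B := A *m swap_basis u v in
  ((swap_basis u v)^T *m A *m swap_basis u v) i j =
  if j == u then B u i + B v i else if j == v then B v i - B u i else B j i.
Proof.
move=> uv symA B; rewrite -{1}symA -trmx_mul mulmx_swap_basis //.
by rewrite !mxE.
Qed.

Lemma swap_basis_orthogonal n (u v : 'I_n) : u != v ->
  (swap_basis u v)^T *m swap_basis u v =
  diag_mx (\row_i (if (i == u) || (i == v) then 2 else 1)).
Proof.
move=> uv; have vu : v != u by rewrite eq_sym.
apply/matrixP => i j; rewrite -[_^T]mulmx1 swap_basis_congr ?trmx1 //.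
rewrite !mulmx_swap_basis // !mxE.
case: (eqVneq j u) => [ju|ju]; case: (eqVneq i u) => [iu|iu];
  try subst j; try subst i; rewrite ?eqxx ?(negPf uv) ?(negPf vu) //=.
- by rewrite addr0 add0r.
- rewrite (negPf iu) mulr0n [v == i]eq_sym; case: eqVneq => _; last by rewrite addr0.
  by rewrite sub0r subr0 addNr.
- rewrite [u == j]eq_sym (negPf ju) mulr0n; case: eqVneq => _; last by rewrite addr0.
  by rewrite add0r addr0 subrr.
rewrite [v == i]eq_sym [j == i]eq_sym.
case: (eqVneq j v) => [->|jv]; case: (eqVneq i v) => [iv|iv] //=.
- by rewrite sub0r subr0 opprK.
- by rewrite subr0.
by rewrite iv eq_sym (negPf jv) subr0 mulr0n.
Qed.

(** For [w] outside [u] and [v], the sum of the entries at [(w, u)] and [(w, v)] is kept and their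
    difference is replaced by its absolute value, which is domination in the swap basis. The private
    neighbours [a] of [u] and [b] of [v] make the entry pairing [e_u + e_v] with [e_v - e_u]
    strictly larger. *)
Lemma SLEE_lt_kelmans n (G : sgraph n) (u v a b : 'I_n) : u != v ->
  a != v -> G a u -> ~~ G a v -> b != u -> G b v -> ~~ G b u ->
  SLEE R G < SLEE R (kelmans G u v).
Proof.
move=> uv av Gau nGav bu Gbv nGbu; have vu : v != u by rewrite eq_sym.
have au : a != u by apply: contraTneq Gau => ->; rewrite adj_irrefl.
have bv : b != v by apply: contraTneq Gbv => ->; rewrite adj_irrefl.
set K := kelmans G u v.
pose g x y : R := (G x y)%:R; pose k x y : R := (K x y)%:R.
pose A := signless_laplacian R G; pose B := signless_laplacian R K.
have symA i j : A i j = A j i by rewrite /A -{1}(signless_laplacian_sym R G) mxE.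
have symB i j : B i j = B j i by rewrite /B -{1}(signless_laplacian_sym R K) mxE.
have ksum w : w != u -> w != v -> k w u + k w v = g w u + g w v.
  move=> wu wv; rewrite /k /g kelmans_src // kelmans_dst //.
  by case: (G w u); case: (G w v); rewrite /= ?add0r ?addr0.
have kdiff w : w != u -> w != v -> k w v - k w u = `|g w v - g w u|.
  move=> wu wv; rewrite /k /g kelmans_src // kelmans_dst //.
  by case: (G w u); case: (G w v); rewrite /= ?subrr ?sub0r ?subr0;
    rewrite ?normrN ?normr0 ?normr1.
have degD (F : rel 'I_n) x : \sum_z (F x z)%:R =
    (F x u)%:R + ((F x v)%:R + \sum_(z | (z != u) && (z != v)) (F x z)%:R) :> R.
  by rewrite (bigD1 u) //= (bigD1 v).
have gsym x y : g x y = g y x by rewrite /g adj_sym.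
have ksym x y : k x y = k y x by rewrite /k [K x y]adj_sym.
have guu : g u u = 0 by rewrite /g adj_irrefl.
have gvv : g v v = 0 by rewrite /g adj_irrefl.
have kuu : k u u = 0 by rewrite /k [K u u]adj_irrefl.
have kvv : k v v = 0 by rewrite /k [K v v]adj_irrefl.
have kuv : k u v = g u v by rewrite /k kelmans_src_dst.
have Auu : A u u = g u v + \sum_(z | (z != u) && (z != v)) g z u.
  rewrite /A signless_laplacianE eqxx degD -!/(g _ _) guu add0r; congr (_ + _).
  by apply: eq_bigr => z _; rewrite -/(g _ _) gsym.
have Avv : A v v = g u v + \sum_(z | (z != u) && (z != v)) g z v.
  rewrite /A signless_laplacianE eqxx degD -!/(g _ _) gvv add0r gsym; congr (_ + _).
  by apply: eq_bigr => z _; rewrite -/(g _ _) gsym.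
have Buu : B u u = g u v + \sum_(z | (z != u) && (z != v)) k z u.
  rewrite /B signless_laplacianE eqxx degD -!/(k _ _) kuu add0r kuv; congr (_ + _).
  by apply: eq_bigr => z _; rewrite -/(k _ _) ksym.
have Bvv : B v v = g u v + \sum_(z | (z != u) && (z != v)) k z v.
  rewrite /B signless_laplacianE eqxx degD -!/(k _ _) kvv add0r ksym kuv.
  by congr (_ + _); apply: eq_bigr => z _; rewrite -/(k _ _) ksym.
have Buv : B u v = A u v by rewrite /A /B !signless_laplacianE (negPf uv) -/(k _ _) kuv.
have BD : B u u + B v v = A u u + A v v.
  rewrite Buu Bvv Auu Avv addrACA [RHS]addrACA -!big_split /=; congr (_ + _).
  by apply: eq_bigr => z /andP[zu zv]; rewrite ksum.
(* The terms of [a] and [b] are -1 and 1: they cancel on the left but contribute 2 on the right,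
   which makes the triangle inequality strict. *)
have Bdiff : `|A v v - A u u| < B v v - B u u.
  have gk (F : 'I_n -> 'I_n -> R) :
      g u v + \sum_(z | (z != u) && (z != v)) F z v
      - (g u v + \sum_(z | (z != u) && (z != v)) F z u)
      = \sum_(z | (z != u) && (z != v)) (F z v - F z u).
    by rewrite opprD addrACA subrr add0r -sumrB.
  rewrite Avv Auu Bvv Buu !gk.
  have -> : \sum_(z | (z != u) && (z != v)) (k z v - k z u) =
      \sum_(z | (z != u) && (z != v)) `|g z v - g z u|.
    by apply: eq_bigr => z /andP[zu zv]; rewrite kdiff.
  have ba : b != a by apply: contraTneq Gbv => ->.
  rewrite (bigD1 a) ?au //= [ltRHS](bigD1 a) ?au //=.
  rewrite (bigD1 b) ?bu ?bv //= [X in _ < _ + X](bigD1 b) ?bu ?bv //=.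
  rewrite /g Gau (negPf nGav) Gbv (negPf nGbu) sub0r subr0 normrN normr1.
  rewrite addrA addNr add0r.
  apply: le_lt_trans (ler_norm_sum _ _ _) _.
  by rewrite addrA ltrDr addr_gt0.
have Bout i j : i != u -> i != v -> j != u -> j != v -> B i j = A i j.
  move=> iu iv ju jv; rewrite /A /B !signless_laplacianE; case: eqVneq => [_|_].
    rewrite !degD !addrA -!/(k _ _) -!/(g _ _) ksum //; congr (_ + _).
    by apply: eq_bigr => z /andP[zu zv]; rewrite kelmans_out.
  by rewrite kelmans_out.
have BDout i : i != u -> i != v -> B i u + B i v = A i u + A i v.
  by move=> iu iv; rewrite /A /B !signless_laplacianE (negPf iu) (negPf iv); apply: ksum.
have Bdout i : i != u -> i != v -> `|A i v - A i u| <= B i v - B i u.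
  move=> iu iv; rewrite /A /B !signless_laplacianE (negPf iu) (negPf iv).
  by rewrite -!/(k _ _) -!/(g _ _) kdiff.
have A_ge0 i j : 0 <= A i j by exact: signless_laplacian_ge0.
have AuvE : A u v = g u v by rewrite /A signless_laplacianE (negPf uv).
(* The diagonal entry of [A] at [e_v - e_u] is nonnegative, since both degrees count the possible
   edge [u v]. *)
have Auv_le : A u v + A u v <= A u u + A v v.
  rewrite AuvE Auu Avv addrACA lerDl addr_ge0 ?sumr_ge0 //.
have symAT : A^T = A by exact: signless_laplacian_sym.
have symBT : B^T = B by exact: signless_laplacian_sym.
rewrite /SLEE -/A -/B; move: symAT symBT.
clear Auu Avv Buu Bvv AuvE; clearbody A B => symAT symBT.
apply: (sum_expR_eigenvalues_lt (P := swap_basis u v) (i0 := u) (j0 := v) symAT symBT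
  _ (swap_basis_orthogonal uv)).
- by move=> i; rewrite mxE; case: ifP.
- move=> i j; rewrite !swap_basis_congr // !mulmx_swap_basis //.
  case: (eqVneq j u) => [ju|ju]; case: (eqVneq i u) => [iu|iu];
    try subst j; try subst i; rewrite ?(symA v u) ?(symB v u) ?Buv.
  + by rewrite ger0_norm ?addr_ge0 //; lra.
  + case: (eqVneq i v) => [_|iv].
      by rewrite ler_norml; move: Bdiff; rewrite ltr_norml; lra.
    rewrite !(symA _ i) !(symB _ i) ger0_norm ?addr_ge0 //.
    by rewrite BDout.
  + case: (eqVneq j v) => [_|jv].
      by rewrite ler_norml; move: Bdiff; rewrite ltr_norml; lra.
    by rewrite ger0_norm ?addr_ge0 // BDout.
  case: (eqVneq j v) => [jv|jv]; case: (eqVneq i v) => [iv|iv].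
  + by rewrite ger0_norm; lra.
  + by rewrite !(symA _ i) !(symB _ i) Bdout.
  + by rewrite Bdout.
  by rewrite ger0_norm // Bout.
rewrite !swap_basis_congr // !mulmx_swap_basis // (negPf vu) !eqxx.
rewrite ?(symA v u) ?(symB v u) ?Buv.
by move: Bdiff; rewrite !ltr_norml; lra.
Qed.

End SLEEMonotone.

(** * Isomorphism invariance, connectivity and cut edges *)

Lemma sgraph_ext n (G H : sgraph n) : (forall x y, G x y = H x y) -> G = H.
Proof.
case: G => g gs gi; case: H => h hs hi /= gh.
have {}gh : g = h by apply/funext => x; apply/funext => y.
by subst h; rewrite (Prop_irrelevance gs hs) (Prop_irrelevance gi hi).
Qed.

(** Relabelling conjugates the signless Laplacian by a permutation matrix, and the index depends
    only on the characteristic polynomial. *)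
Lemma SLEE_iso (R : realType) n (G H : sgraph n) :
  graph_iso G H -> SLEE R G = SLEE R H.
Proof.
move=> [f GH].
rewrite /SLEE /eigenvalues; suff -> : signless_laplacian R G =
    invmx (perm_mx f^-1) *m signless_laplacian R H *m perm_mx f^-1.
  by rewrite char_poly_similar ?unitmx_perm.
have uf : (perm_mx f^-1 : 'M[R]_n) \in unitmx by rewrite unitmx_perm.
have -> : invmx (perm_mx f^-1) = perm_mx f :> 'M[R]_n.
  by rewrite -[RHS](mulmxK uf) -perm_mxM mulgV perm_mx1 mul1mx.
have permE (A : 'M[R]_n) x y : (perm_mx f *m A *m perm_mx f^-1) x y = A (f x) (f y).
  by rewrite -row_permE -col_permE !mxE.
apply/matrixP => x y; rewrite permE !signless_laplacianE (inj_eq perm_inj) GH.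
case: ifP => _ //; rewrite [RHS](reindex_inj (@perm_inj _ f)) /=.
by apply: eq_bigr => z _; rewrite GH.
Qed.

Lemma set2_eq (T : finType) (a b c d : T) :
  [set a; b] = [set c; d] -> (a = c /\ b = d) \/ (a = d /\ b = c).
Proof.
move=> E.
have : a \in [set c; d] by rewrite -E set21.
have : b \in [set c; d] by rewrite -E set22.
have : c \in [set a; b] by rewrite E set21.
have : d \in [set a; b] by rewrite E set22.
rewrite !inE.
do 4! case/orP=> /eqP ?; subst; auto.
Qed.

Lemma connect_adj_sym n (G : sgraph n) : connect_sym G.
Proof. exact/sym_connect_sym/adj_sym. Qed.

Lemma graph_connectedP n (G : sgraph n) :
  reflect (forall x y, connect G x y) (graph_connected G).
Proof.
apply: (iffP forallP) => [c x y|c x]; last exact/forallP.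
by have /forallP := c x.
Qed.

Section Bridges.
Variables (n : nat) (G : sgraph n).
Implicit Types (x y : 'I_n) (E : {set 'I_n}).

Lemma edgesP E : reflect (exists x y, G x y /\ E = [set x; y]) (E \in edges G).
Proof.
apply: (iffP imsetP) => [[[x y]]|[x [y [Gxy ->]]]].
  by rewrite inE /= => Gxy ->; exists x, y.
by exists (x, y) => //; rewrite inE.
Qed.

(** If the two ends remain connected after the deletion, every walk of [G] can be rerouted around
    the deleted edge. *)
Lemma cut_edges_set2 x y : graph_connected G -> G x y ->
  ([set x; y] \in cut_edges G) = ~~ connect (del_edge G [set x; y]) x y.
Proof.
move=> /graph_connectedP cG Gxy; rewrite inE.
have -> : [set x; y] \in edges G by apply/edgesP; exists x, y.
rewrite andTb; congr (~~ _); apply/graph_connectedP/idP => // cxy a b.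
apply: connect_sub (cG a b) => {}a {}b Gab.
have [|ne] := eqVneq [set a; b] [set x; y].
  by case/set2_eq=> [][-> ->] //; rewrite connect_adj_sym.
by apply: connect1; rewrite /= /del_adj Gab.
Qed.

End Bridges.

Lemma graph_connected_sub n (G H : sgraph n) :
  (forall x y, G x y -> connect H x y) -> graph_connected G -> graph_connected H.
Proof.
move=> sub /graph_connectedP cG; apply/graph_connectedP => x y.
exact: connect_sub (cG x y).
Qed.

(** The edge [u v] survives and all other neighbours of [u] or [v] become neighbours of [v], so
    every lost edge is replaced by a walk through [v]. *)
Lemma kelmans_connected n (G : sgraph n) u v :
  u != v -> G u v -> graph_connected G -> graph_connected (kelmans G u v).
Proof.
move=> uv Guv; have vu : v != u by rewrite eq_sym.
set K := kelmans G u v; apply: graph_connected_sub.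
have sub w : w != u -> w != v -> G w u || G w v -> connect K w v.
  by move=> wu wv Gw; apply: connect1; rewrite kelmans_dst.
have Kuv : connect K u v by apply: connect1; rewrite kelmans_src_dst.
have half x y : x != u -> x != v -> G x y -> connect K x y.
  move=> xu xv Gxy; have [yu|yu] := eqVneq y u.
    rewrite yu in Gxy *; apply: (connect_trans (sub _ xu xv _)); rewrite ?Gxy //.
    by rewrite connect_adj_sym.
  have [yv|yv] := eqVneq y v; first by rewrite yv; apply: sub => //; rewrite -yv Gxy orbT.
  by apply: connect1; rewrite kelmans_out.
move=> x y Gxy; have [/andP[xu xv]|] := boolP ((x != u) && (x != v)).
  exact: half.
have [/andP[yu yv] _|] := boolP ((y != u) && (y != v)).
  by rewrite connect_adj_sym half // adj_sym.
rewrite !negb_and !negbK.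
case/orP=> /eqP ? /orP[]/eqP ?; subst x y => //; by rewrite connect_adj_sym.
Qed.

Lemma leaf_cut_edge n (G : sgraph n) l p : graph_connected G ->
  (forall y, G l y = (y == p)) -> [set l; p] \in cut_edges G.
Proof.
move=> cG Gl; have Glp : G l p by rewrite Gl.
rewrite cut_edges_set2 //; apply/connectP => -[[|z q] /=].
  by move=> _ pl; rewrite pl adj_irrefl in Glp.
by rewrite {1}/del_adj Gl => /andP[/andP[/eqP-> /eqP]].
Qed.

(** * Cut edges under the transformation along a cut edge *)

Section CutEdgeKelmans.
Variables (n : nat) (G : sgraph n) (u v : 'I_n).
Hypotheses (cG : graph_connected G) (Guv : G u v).
Hypothesis uv_cut : [set u; v] \in cut_edges G.

Let K := kelmans G u v.
(** Contraction of the edge [u v] onto [v]. Apart from that edge, [K] is the image of [G] under [f],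
    with [u] left as a leaf at [v]. *)
Let f x := if x == u then v else x.

Let uv : u != v.
Proof. by apply: contraTneq Guv => ->; rewrite adj_irrefl. Qed.

(** A common neighbour would give a detour from [u] to [v] avoiding the cut edge. *)
Lemma cut_edge_no_common_neighbour w : ~~ (G w u && G w v).
Proof.
apply/negP => /andP[Gwu Gwv]; move: uv_cut; rewrite cut_edges_set2 // => /negP; apply.
have wu : w != u by apply: contraTneq Gwu => ->; rewrite adj_irrefl.
have wv : w != v by apply: contraTneq Gwv => ->; rewrite adj_irrefl.
apply: (@connect_trans _ _ w); apply: connect1; rewrite /= /del_adj.
  rewrite adj_sym Gwu; apply/eqP => /set2_eq[[_ /eqP]|[/eqP]].
    by rewrite (negPf wv).
  by rewrite (negPf uv).
rewrite Gwv; apply/eqP => /set2_eq[[/eqP]|[/eqP]].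
  by rewrite (negPf wu).
by rewrite (negPf wv).
Qed.

Let f_neq x : f x != u.
Proof. by rewrite /f; case: (eqVneq x u) => [_|//]; rewrite eq_sym. Qed.

Let f_eq x y : f x = f y -> x != y -> [set x; y] = [set u; v].
Proof.
rewrite /f; case: (eqVneq x u) => [->|xu]; case: (eqVneq y u) => [->|yu].
- by [].
- by move=> <-.
- by move=> ->; rewrite setUC.
by move=> ->; rewrite eqxx.
Qed.

Let kelmans_image x y : G x y -> [set x; y] != [set u; v] -> K (f x) (f y).
Proof.
have half a b : a != u -> a != v -> G a b -> K a (f b).
  move=> au av Gab; rewrite /f; have [bu|bu] := eqVneq b u.
    by rewrite /K kelmans_dst // -bu Gab.
  by have [bv|bv] := eqVneq b v; rewrite /K ?bv ?kelmans_dst ?kelmans_out //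
    -?bv Gab ?orbT.
have fid a : a != u -> f a = a by rewrite /f => /negPf->.
move=> Gxy ne; have [/andP[xu xv]|] := boolP ((x != u) && (x != v)).
  by rewrite (fid x) ?half.
have [/andP[yu yv] _|] := boolP ((y != u) && (y != v)).
  by rewrite adj_sym (fid y) ?half // adj_sym.
rewrite !negb_and !negbK => /orP[]/eqP yE /orP[]/eqP xE; move: Gxy ne;
  by rewrite xE yE ?(adj_irrefl G) ?eqxx // setUC eqxx.
Qed.

Let kelmans_preimage a b : K a b -> [set a; b] != [set u; v] ->
  exists c d, [/\ G c d, f c = a & f d = b].
Proof.
have fid x : x != u -> f x = x by rewrite /f => /negPf->.
have fu : f u = v by rewrite /f eqxx.
have fv : f v = v by rewrite fid // eq_sym.
have half x y : x != u -> x != v -> K x y -> exists2 d, G x d & f d = y.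
  move=> xu xv; have [->|yu] := eqVneq y u.
    by rewrite /K kelmans_src // (negPf (cut_edge_no_common_neighbour x)).
  have [->|yv] := eqVneq y v.
    by rewrite /K kelmans_dst // => /orP[]; [exists u|exists v].
  by rewrite /K kelmans_out //; exists y; rewrite ?fid.
move=> Kab ne; have [/andP[au av]|] := boolP ((a != u) && (a != v)).
  by have [d Gad <-] := half _ _ au av Kab; exists a, d; rewrite fid.
have [/andP[bu bv] _|] := boolP ((b != u) && (b != v)).
  rewrite adj_sym in Kab; have [d Gbd <-] := half _ _ bu bv Kab.
  by exists d, b; rewrite (fid b) // adj_sym.
rewrite !negb_and !negbK => /orP[]/eqP bE /orP[]/eqP aE; move: Kab ne;
  by rewrite aE bE ?adj_irrefl ?eqxx // setUC eqxx.
Qed.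

(** Meant as an injection of the cut edges of [G] into those of [K]: [u v] stays, every other edge
    follows the contraction. *)
Let phi E := if E == [set u; v] then E else f @: E.

Let f_set2 x y : f @: [set x; y] = [set f x; f y].
Proof. by rewrite imsetU1 imset_set1. Qed.

Let phi_inj : {in cut_edges G &, injective phi}.
Proof.
move=> E F; rewrite !inE => /andP[/edgesP[x [y [Gxy ->]]] _].
move=> /andP[/edgesP[z [t [Gzt ->]]] _] {E F}; rewrite /phi.
have notin a b : [set u; v] <> f @: [set a; b].
  move=> /setP/(_ u); rewrite set21 f_set2 !inE => /esym.
  by rewrite ![u == _]eq_sym !(negPf (f_neq _)).
(* Edges with equal images that differ at one end only would have a common neighbour of [u] and [v]
   as shared end; if they differ at both ends, the first is a loop or [u v]. *)
have aux a b c d : G a b -> G c d -> [set a; b] != [set u; v] ->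
    f a = f c -> f b = f d -> [set a; b] = [set c; d].
  move=> Gab Gcd ne fac fbd.
  have [ac|/(f_eq fac) ac] := eqVneq a c; have [bd|/(f_eq fbd) bd] := eqVneq b d.
  - by rewrite ac bd.
  - have := cut_edge_no_common_neighbour a; move: Gcd; rewrite -ac => Gad.
    by case: (set2_eq bd) Gab Gad => [][-> ->] -> ->.
  - have := cut_edge_no_common_neighbour b; move: Gcd Gab.
    by rewrite -bd ![G _ b]adj_sym; case: (set2_eq ac) => [][-> ->] -> ->.
  move: Gab ne; case: (set2_eq ac) => [][-> _]; case: (set2_eq bd) => [][-> _];
    by rewrite ?adj_irrefl ?eqxx // setUC eqxx.
case: (eqVneq [set x; y] _) => [->|ne1]; case: (eqVneq [set z; t] _) => [->|ne2] //.
- by move=> /notin.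
- by move=> /esym/notin.
rewrite !f_set2 => /set2_eq[[]|[]]; first exact: aux.
by rewrite [[set z; t]]setUC; apply: aux => //; rewrite adj_sym.
Qed.

(** In [K] the edge [u v] is pendant. For another cut edge, a path in [K] avoiding its image lifts
    to [G] without that edge, because [u v] is still there and joins each vertex to its image under
    [f]. *)
Let phi_cut E : E \in cut_edges G -> phi E \in cut_edges K.
Proof.
have cK : graph_connected K by exact: kelmans_connected.
move=> cutE; rewrite /phi; case: eqVneq => [->|].
  apply: leaf_cut_edge => // y; have [->|yv] := eqVneq y v.
    by rewrite /K kelmans_src_dst.
  have [->|yu] := eqVneq y u; first by rewrite adj_irrefl.
  by rewrite adj_sym /K kelmans_src // (negPf (cut_edge_no_common_neighbour y)).
move: (cutE); rewrite inE => /andP[/edgesP[x [y [Gxy Exy]]] _]; subst E => ne.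
rewrite f_set2 cut_edges_set2 ?kelmans_image //; move: cutE.
rewrite cut_edges_set2 //; apply: contra => cKf.
set D := del_edge G [set x; y].
have cD : connect_sym D by exact: connect_adj_sym.
have Duv : connect D u v.
  by apply: connect1; rewrite /= /del_adj Guv eq_sym.
have Df a : connect D a (f a).
  by rewrite /f; case: eqVneq => [->|_]; rewrite ?connect0.
apply: connect_trans (Df x) _; rewrite cD; apply: connect_trans (Df y) _; rewrite cD.
apply: connect_sub cKf => a b /andP[Kab neab].
have [/set2_eq[][-> ->] //|/(kelmans_preimage Kab)] := eqVneq [set a; b] [set u; v].
  by rewrite cD.
move=> [c [d [Gcd fc fd]]]; subst a b.
apply: connect_trans (connect_trans _ (Df d)); first by rewrite cD.
apply: connect1; rewrite /= /del_adj Gcd; apply: contra neab => /eqP E.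
by rewrite -!f_set2 E.
Qed.

Lemma kelmans_cut_edges : (#|cut_edges G| <= #|cut_edges K|)%N.
Proof.
rewrite -(card_in_imset phi_inj); apply/subset_leq_card/subsetP.
by move=> _ /imsetP[E cutE ->]; apply: phi_cut.
Qed.

End CutEdgeKelmans.

(** * Existence of a maximizer *)

Lemma exists_SLEE_max (R : realType) n (P : pred (sgraph n)) (G : sgraph n) :
  P G -> exists2 M, P M & forall H, P H -> SLEE R H <= SLEE R M.
Proof.
(* Graphs are encoded by sets of ordered pairs, which form a finite type; symmetrizing and dropping
   the diagonal lets every set decode to a graph. *)
pose e (E : {set 'I_n * 'I_n}) : rel 'I_n := fun x y =>
  (x != y) && (((x, y) \in E) || ((y, x) \in E)).
have e_sym E : symmetric (e E) by move=> x y; rewrite /e eq_sym orbC.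
have e_irr E : irreflexive (e E) by move=> x; rewrite /e eqxx.
pose g E := SGraph (e_sym E) (e_irr E).
pose c (H : sgraph n) : {set 'I_n * 'I_n} := [set p | H p.1 p.2].
have cK H : g (c H) = H.
  apply: sgraph_ext => x y; rewrite /= /e !inE /= [H y x]adj_sym orbb.
  by case: eqVneq => // ->; rewrite adj_irrefl.
rewrite -(cK G) => PG.
case: (arg_maxP (P := fun E => P (g E)) (fun E => SLEE R (g E)) PG) => E PE maxE.
by exists (g E) => // H; rewrite -(cK H) => PH; apply: maxE.
Qed.

Section AddEdge.
Variables (n : nat) (G : sgraph n) (a b : 'I_n).

(** The condition [x != y] keeps the relation irreflexive even when [a = b]. *)
Definition add_edge_adj : rel 'I_n := fun x y =>
  G x y || (x != y) && ([set x; y] == [set a; b]).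

Lemma add_edge_adj_sym : symmetric add_edge_adj.
Proof. by move=> x y; rewrite /add_edge_adj adj_sym eq_sym setUC. Qed.

Lemma add_edge_adj_irrefl : irreflexive add_edge_adj.
Proof. by move=> x; rewrite /add_edge_adj adj_irrefl eqxx. Qed.

Definition add_edge : sgraph n := SGraph add_edge_adj_sym add_edge_adj_irrefl.

End AddEdge.

(** * Sets of leaves and their labelling *)

Lemma exists_subset_card (T : finType) (A : {set T}) k :
  (k <= #|A|)%N -> exists2 B : {set T}, B \subset A & #|B| = k.
Proof.
move=> le_kA; exists [set x in take k (enum A)].
  by apply/subsetP => x; rewrite inE => /mem_take; rewrite mem_enum.
by rewrite cardsE (card_uniqP _) ?take_uniq ?enum_uniq // size_takel // -cardE.
Qed.

(** Taking [p] outside [L] rules out two leaves joined to each other, so distinct leaves have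
    distinct edges. *)
Definition pendant_set n (G : sgraph n) (L : {set 'I_n}) :=
  forall l, l \in L -> exists2 p, p \notin L & forall y, G l y = (y == p).

(** The default [l] occurs only for an isolated vertex. *)
Definition pendant_edge n (G : sgraph n) l := [set l; odflt l [pick y | G l y]].

Lemma pendant_edgeE n (G : sgraph n) l p :
  (forall y, G l y = (y == p)) -> pendant_edge G l = [set l; p].
Proof.
rewrite /pendant_edge => Gl; case: pickP => [y|/(_ p)]; rewrite Gl ?eqxx //.
by move=> /eqP->.
Qed.

Lemma pendant_set_cut_edges n (G : sgraph n) L : graph_connected G ->
  pendant_set G L -> (#|L| <= #|cut_edges G|)%N.
Proof.
move=> cG pL.
have h_inj : {in L &, injective (pendant_edge G)}.
  move=> l m lL mL; have [p pnL /pendant_edgeE->] := pL l lL.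
  have [q qnL /pendant_edgeE->] := pL m mL.
  by case/set2_eq=> [[]|[lq _]] //; rewrite -lq lL in qnL.
rewrite -(card_in_imset h_inj); apply/subset_leq_card/subsetP => _ /imsetP[l lL ->].
by have [p _ Gl] := pL l lL; rewrite (pendant_edgeE Gl) leaf_cut_edge.
Qed.

(** Produces the labelling of [pendant_clique] by listing the hub [z], then the other vertices
    outside [L], then [L], and taking positions in this list. *)
Lemma exists_perm_split n (L : {set 'I_n}) z : z \notin L ->
  exists f : {perm 'I_n}, (forall x, (f x == 0 :> nat) = (x == z)) /\
    (forall x, (f x < n - #|L|)%N = (x \notin L)).
Proof.
move=> zL; have cardCL : #|~: L| = (n - #|L|)%N by rewrite cardsCs setCK card_ord.
pose s1 := z :: enum (~: L :\ z); pose s := s1 ++ enum L.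
have mem_s1 x : (x \in s1) = (x \notin L).
  by rewrite inE mem_enum !inE; case: eqVneq => [->|//]; rewrite zL.
have size_s1 : size s1 = (n - #|L|)%N.
  by rewrite -cardCL /= -cardE [in RHS](cardsD1 z) inE zL.
have s_full x : x \in s.
  by rewrite mem_cat mem_s1 mem_enum; case: (x \in L).
have size_s : size s = n.
  by rewrite size_cat size_s1 -cardE subnK // -[X in (_ <= X)%N]card_ord max_card.
have idx_lt x : (index x s < n)%N by rewrite -[X in (_ < X)%N]size_s index_mem.
pose f x := Ordinal (idx_lt x).
have fE x : f x = index x s :> nat by [].
have f_inj : injective f.
  by move=> x y /(congr1 val) /= /(congr1 (nth z s)); rewrite !nth_index.
have f_lt x : (f x < n - #|L|)%N = (x \notin L).
  rewrite fE index_cat mem_s1; case: ifP => [xL|_].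
    by rewrite -size_s1 index_mem mem_s1 xL.
  by rewrite size_s1 ltnNge leq_addr.
have f0 x : (f x == 0 :> nat) = (x == z).
  by rewrite fE /s /= [RHS]eq_sym; case: (z == x).
exists (perm f_inj); split=> x; rewrite permE; [exact: f0 | exact: f_lt].
Qed.

(** * Structure of a maximizer *)

Section Maximizer.
Variables (R : realType) (n r : nat) (G : sgraph n).
Hypotheses (hr : (r + 3 <= n)%N) (cG : graph_connected G).
Hypothesis r_cut : (r <= #|cut_edges G|)%N.
Hypothesis maxG : forall H : sgraph n, graph_connected H -> (r <= #|cut_edges H|)%N ->
  SLEE R H <= SLEE R G.

(** Otherwise each end has a further neighbour; it is private, as ends of a cut edge share none, and
    the transformation improves [G] without losing cut edges. *)
Lemma maximizer_cut_edge u v : G u v -> [set u; v] \in cut_edges G ->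
  (forall y, G u y = (y == v)) \/ (forall y, G v y = (y == u)).
Proof.
move=> Guv cut_uv.
have [/forallP pu|] := boolP [forall y, G u y == (y == v)].
  by left=> y; exact/eqP.
have [/forallP pv|] := boolP [forall y, G v y == (y == u)].
  by right=> y; exact/eqP.
move=> /forallPn[b Gvb] /forallPn[a Gua].
have priv x y z : G x y -> G x z != (z == y) -> z != y /\ G z x.
  by move=> Gxy; case: (eqVneq z y) => [->|_]; rewrite ?Gxy // [G z x]adj_sym;
    case: (G x z).
have [av Gau] := priv _ _ _ Guv Gua.
have [bu Gbv] := priv v u b (etrans (adj_sym _ _ _) Guv) Gvb.
have nc := cut_edge_no_common_neighbour cG Guv cut_uv.
have uv : u != v by apply: contraTneq Guv => ->; rewrite adj_irrefl.
have nGav : ~~ G a v by move: (nc a); rewrite Gau.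
have nGbu : ~~ G b u by move: (nc b); rewrite Gbv andbT.
have := SLEE_lt_kelmans R uv av Gau nGav bu Gbv nGbu.
rewrite ltNge maxG ?kelmans_connected //.
exact: leq_trans r_cut (kelmans_cut_edges cG Guv cut_uv).
Qed.

(** Every cut edge is the pendant edge of some vertex of degree 1, so there are at least [r] such
    vertices to choose from. *)
Lemma maximizer_pendant_set : exists2 L, pendant_set G L & #|L| = r.
Proof.
pose leaf l p := [forall y, G l y == (y == p)].
have leafP l p : reflect (forall y, G l y = (y == p)) (leaf l p).
  by apply: (iffP forallP) => Gl y; exact/eqP.
pose L := [set l | [exists p, leaf l p]].
have : (r <= #|L|)%N.
  apply: leq_trans r_cut _; apply: leq_trans (leq_imset_card (pendant_edge G) L).
  apply/subset_leq_card/subsetP => E cutE.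
  move: (cutE); rewrite inE => /andP[/edgesP[x [y [Gxy Exy]]] _].
  rewrite Exy in cutE *; have [Gx|Gy] := maximizer_cut_edge Gxy cutE.
    rewrite -(pendant_edgeE Gx); apply: imset_f; rewrite inE.
    by apply/existsP; exists y; apply/leafP.
  rewrite setUC -(pendant_edgeE Gy); apply: imset_f; rewrite inE.
  by apply/existsP; exists x; apply/leafP.
move=> /exists_subset_card[L0 /subsetP sL0 cardL0]; exists L0 => // l lL0.
have := sL0 l lL0; rewrite inE => /existsP[p /leafP Gl].
exists p => //; apply/negP => /sL0; rewrite inE => /existsP[q /leafP Gp].
(* If the neighbour [p] of [l] also had degree 1, then [l] and [p] would form a whole component,
   impossible in a connected graph on at least 3 vertices. *)
have lq : l = q by apply/eqP; rewrite -Gp adj_sym Gl.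
subst q; have [w] : exists w, w \notin [set l; p].
  apply/existsP; rewrite -negb_forall; apply/negP => /forallP all_in.
  have : (#|'I_n| <= #|[set l; p]|)%N by apply/subset_leq_card/subsetP => x _.
  rewrite card_ord cards2 leqNgt => /negP; apply.
  by apply: leq_trans hr; rewrite addnS addn2 !ltnS; case: (_ != _).
have closed_lp : fingraph.closed G [set l; p].
  apply: intro_closed; first exact: connect_adj_sym.
  by move=> x y /[swap] /set2P[]->; rewrite ?Gl ?Gp => /eqP->; rewrite ?set21 ?set22.
by rewrite -(closed_connect closed_lp (graph_connectedP _ cG l w)) set21.
Qed.

(** From here on, keeping [r] leaves pendant replaces counting cut edges when [G] is modified. *)
Lemma pendant_set_maximizer_ge (H : sgraph n) (L : {set 'I_n}) :
  #|L| = r -> graph_connected H -> pendant_set H L -> SLEE R H <= SLEE R G.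
Proof. by move=> cardL cH pL; rewrite maxG // -cardL pendant_set_cut_edges. Qed.

Lemma maximizer_clique L x y : pendant_set G L -> #|L| = r ->
  x \notin L -> y \notin L -> x != y -> G x y.
Proof.
move=> pL cardL xL yL xy; apply: contraT => nGxy.
have subG : subrel G (add_edge G x y) by move=> a b /= Gab; rewrite /add_edge_adj Gab.
have : SLEE R G < SLEE R (add_edge G x y).
  by apply: SLEE_lt_subgraph nGxy _ => //=; rewrite /add_edge_adj xy eqxx orbT.
rewrite ltNge (pendant_set_maximizer_ge cardL) //.
  by apply: graph_connected_sub cG => a b /subG; apply: connect1.
move=> l lL; have [p pnL Gl] := pL l lL; exists p => // z.
rewrite /= /add_edge_adj Gl; case: (z == p) => //=; apply/negP => /andP[_ /eqP].
move=> /setP/(_ l); rewrite !inE eqxx /= => /esym/orP[]/eqP lE.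
  by rewrite -lE lL in xL.
by rewrite -lE lL in yL.
Qed.

(** Were [p] and [q] distinct, [k] and [l] would be private neighbours of them, and the
    transformation would improve [G] while keeping [L] pendant. *)
Lemma maximizer_pendants_adjacent L k l p q : pendant_set G L -> #|L| = r ->
  k \in L -> l \in L -> G k p -> G l q -> p = q.
Proof.
move=> pL cardL kL lL Gkp Glq; apply/eqP; apply: contraT => pq.
have [p' pL' Gk] := pL k kL; have [q' qL' Gl] := pL l lL.
have ? : p = p' by apply/eqP; rewrite -Gk.
have ? : q = q' by apply/eqP; rewrite -Gl.
subst p' q'.
have notin x y : x \in L -> y \notin L -> x != y.
  by move=> xL; apply: contraNneq => <-.
have : SLEE R G < SLEE R (kelmans G p q).
  have qp : q != p by rewrite eq_sym.
  apply: (@SLEE_lt_kelmans R _ _ _ _ k l) => //; try exact: notin.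
    by rewrite Gk.
  by rewrite Gl.
rewrite ltNge (pendant_set_maximizer_ge cardL) ?kelmans_connected //.
  exact: maximizer_clique cardL _ _ pq.
move=> m mL; have [w wnL Gm] := pL m mL.
(* Leaves hanging on [p] move to [q]; all others keep their neighbour. *)
pose w' := if w == p then q else w; exists w'; first by rewrite /w'; case: ifP.
have mp := notin m p mL pL'; have mq := notin m q mL qL'.
move=> y; rewrite /w'; have [->|yp] := eqVneq y p.
  rewrite kelmans_src // !Gm; case: (eqVneq p w) => [<-|pw].
    by rewrite eq_sym.
  by rewrite (negPf pw).
have [->|yq] := eqVneq y q.
  rewrite kelmans_dst // !Gm [p == w]eq_sym; case: (w == p) => //=.
  by rewrite eqxx.
rewrite kelmans_out // Gm; case: (eqVneq w p) => [->|//].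
by rewrite (negPf yp) (negPf yq).
Qed.

Lemma maximizer_iso : graph_iso G (pendant_clique n r).
Proof.
have [L pL cardL] := maximizer_pendant_set.
have [z zL Gz] : exists2 z, z \notin L & forall l, l \in L -> forall y, G l y = (y == z).
  (* Without leaves any vertex can serve as hub. *)
  have [L0|[l lL]] := set_0Vmem L.
    have n_gt0 : (0 < n)%N by apply: leq_trans hr; rewrite addn3.
    by exists (Ordinal n_gt0) => [|l]; rewrite L0 inE.
  have [z zL Gl] := pL l lL; exists z => // k kL y.
  have [w wL Gk] := pL k kL.
  rewrite Gk (@maximizer_pendants_adjacent L k l w z) ?Gk ?Gl //.
have [f [f0]] := exists_perm_split zL; rewrite cardL => f_lt.
exists f => x y; rewrite -[pendant_clique n r _ _]/(pendant_clique_adj r _ _).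
rewrite /pendant_clique_adj (inj_eq perm_inj) !f_lt !f0.
rewrite ![(n - r <= _)%N]leqNgt !f_lt !negbK.
have [->|xy] := eqVneq x y; first by rewrite adj_irrefl.
have [xL|xL] := boolP (x \in L).
  rewrite Gz //= (negPf (_ : x != z)) ?andbT //.
  by apply: contraNneq zL => <-.
have [yL|yL] := boolP (y \in L); last by rewrite (maximizer_clique pL).
rewrite adj_sym Gz //= andbT andbF orbF //.
Qed.

End Maximizer.

Theorem theorem4p3 (R : realType) (n r : nat) (hr : (r + 3 <= n)%N)
    (G : sgraph n) (hG : connected_with_cut_edges r G) :
  SLEE R G <= SLEE R (pendant_clique n r) /\
  (SLEE R G = SLEE R (pendant_clique n r) <-> graph_iso G (pendant_clique n r)).
Proof.
have [cG cutG] := hG.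
pose P (H : sgraph n) := graph_connected H && (r <= #|cut_edges H|)%N.
have PG : P G by rewrite /P cG cutG leqnn.
(* Stated for an arbitrary maximizer because it serves twice: for [M], which gives the bound, and
   for [G] itself in the equality case. *)
have iso (M : sgraph n) : P M -> (forall H, P H -> SLEE R H <= SLEE R M) ->
    graph_iso M (pendant_clique n r).
  move=> /andP[cM rM] maxM; apply: (maximizer_iso hr cM rM) => H cH rH.
  by apply: maxM; rewrite /P cH.
have [M PM maxM] := exists_SLEE_max R PG.
have SM : SLEE R M = SLEE R (pendant_clique n r) by exact/SLEE_iso/iso.
rewrite -SM; split; first exact: maxM.
by split=> [GM|/(SLEE_iso R) ->//]; apply: iso => // H /maxM; rewrite GM.
Qed.
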